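(* Let $A$ be a finite-dimensional algebra over a field. The closure operator $\mathrm{qcl}$ on $\mathrm{ind}\,A$ satisfies anti-exchange: if $\mathcal Q\subseteq\mathrm{ind}\,A$ satisfies $\mathrm{qcl}(\mathcal Q)=\mathcal Q$ and $X,Y\in\mathrm{ind}\,A\setminus\mathcal Q$ are distinct (i.e. nonisomorphic), then $$X\in\mathrm{qcl}(\mathcal Q\cup\{Y\})\ \Longrightarrow\ Y\notin\mathrm{qcl}(\mathcal Q\cup\{X\}).$$
   Context: Modules are finitely generated right modules. $\mathrm{ind}\,A$ is a set of representatives of the isomorphism classes of indecomposable $A$-modules. For $\mathcal X\subseteq\mathrm{ind}\,A$, $\mathrm{add}\,\mathcal X$ is the subcategory of direct summands of finite direct sums of modules in $\mathcal X$, $\mathrm{Gen}(\mathrm{add}\,\mathcal X)$ is the subcategory of factor modules of finite direct sums of modules in $\mathcal X$, and $\mathrm{qcl}(\mathcal X)$ is the set of members of $\mathrm{ind}\,A$ lying in $\mathrm{Gen}(\mathrm{add}\,\mathcal X)$. *)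

(* Defs.v *)
From Stdlib Require List.
From mathcomp Require Import all_boot all_order all_algebra all_field.
From mathcomp Require Import boolp classical_sets.

Set Implicit Arguments.
Unset Strict Implicit.
Unset Printing Implicit Defensive.

Import GRing.Theory.

Local Open Scope ring_scope.
Local Open Scope classical_set_scope.

(* A right A-module is a left module over the converse ring A^c, the right    *)
(* action being m . a := a *: m.  For an algebra A over K, the K-vector space *)
(* structure of a module is the restriction of the A-action along K -> A.     *)
Notation rmodType A := (lmodType A^c).

Section Modules.
Variable R : pzRingType.
Implicit Types M N U V : lmodType R.

Definition fin_gen M : Prop :=
  exists (n : nat) (g : 'I_n -> M),
    forall x, exists c : 'I_n -> R, x = \sum_(i < n) c i *: g i.

Definition iso_mod M N : Prop :=
  exists f : {linear M -> N}, bijective f.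

Definition zero_mod M : Prop := forall x : M, x = 0.

Definition indecomposable M : Prop :=
  ~ zero_mod M /\
  (forall U V, iso_mod M (U * V)%type -> zero_mod U \/ zero_mod V).

(* A choice of the set ind is a family of modules S indexed by a type I which *)
(* hits every isomorphism class of finitely generated indecomposable modules  *)
(* exactly once.  Members of ind are denoted by their indices and subsets of  *)
(* ind are sets of indices, because the type lmodType R of all modules is too *)
(* large to be the argument of set.                                           *)
Definition ind_representatives (I : Type) (S : I -> lmodType R) : Prop :=
  [/\ forall i, fin_gen (S i) /\ indecomposable (S i),
      forall M, fin_gen M -> indecomposable M -> exists i, iso_mod M (S i)
    & forall i j, iso_mod (S i) (S j) -> i = j].

Section Closure.
Variables (I : Type) (S : I -> lmodType R).

Fixpoint dsum (s : seq I) : lmodType R :=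
  if s is i :: s' then (S i * dsum s')%type else 'rV[R]_0.

(* Membership of M in Gen(add X): M is a factor module of a finite direct sum *)
(* (with repetitions allowed) of members of X.                                *)
Definition Gen_add (X : set I) M : Prop :=
  exists s : seq I, List.Forall X s /\
    exists f : {linear dsum s -> M}, forall y, exists x, f x = y.

Definition qcl (X : set I) : set I := [set i | Gen_add X (S i)].

End Closure.

End Modules.

(* Main.v *)
Require Import Defs.
From mathcomp Require Import all_boot all_order all_algebra all_field.
From HB Require Import structures.
From mathcomp Require Import boolp classical_sets.
From mathcomp Require Import ring.

(**
Suppose that X is generated by Q and Y, and Y by Q and X.  Let Z be the trace
of Q in X, the sum of the images of all homomorphisms from members of Q to X.
Every element of X is a sum of elements of Z and of images h y with h : Y -> X;
expanding each y in the same way over Q and X shows that X is the sum of Z and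
of the images of the composites h k : X -> Y -> X.

If some h k is bijective, then k is a split monomorphism into the indecomposable
Y, hence an isomorphism, and X = Y.  Otherwise all the h k lie in the radical J
of the local ring E = End X, so that X = Z + J X with Z an E-submodule of X.  As
X is finite-dimensional it is finitely generated over E, and Nakayama's lemma
[nakayama] gives X = Z.  Since X is finitely generated over A, finitely many
homomorphisms from Q already cover it [Gen_add_trace]: X lies in qcl Q = Q, a
contradiction.

That E is local [fitting_bijective] is a form of Fitting's lemma.  By
Cayley-Hamilton an endomorphism f is annihilated by a nonzero polynomial, and
after multiplication by the variable T it has the form T^(m+1) q with q(0) != 0.  The Bezout relation between the
two coprime factors yields an idempotent of K[f], and idempotents of E are
trivial because X is indecomposable; according to its value, f is invertible or
nilpotent, and in the latter case 1 - f is invertible.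

Ideals of E and E-submodules of X enter only as predicates: E-submodules are the
[endo_stable] predicates, J is the set of nonbijective endomorphisms, and the
equation X = Z + J X is expressed by saying that every E-submodule which contains
Z and J X is all of X.  No ring structure on E is ever built.
*)

Set Implicit Arguments.
Unset Strict Implicit.
Unset Printing Implicit Defensive.

Import GRing.Theory.

Local Open Scope ring_scope.
Local Open Scope classical_set_scope.

(** * Kernels as modules *)

Section Kernel.
Variables (R : pzRingType) (M N : lmodType R) (f : {linear M -> N}).

Definition ker_pred : {pred M} := [pred x | f x == 0].

Fact ker_submod_closed : submod_closed ker_pred.
Proof.
split=> [|a x y]; rewrite !inE ?linear0 // => /eqP fx /eqP fy.
by rewrite linearP fx fy scaler0 addr0.
Qed.
HB.instance Definition _ := GRing.isSubmodClosed.Build R M ker_pred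
  ker_submod_closed.

Record kernel := Kernel { kernel_val : M; _ : kernel_val \in ker_pred }.
HB.instance Definition _ := [isSub for kernel_val].
HB.instance Definition _ := [Choice of kernel by <:].
HB.instance Definition _ := [SubChoice_isSubLmodule of kernel by <:].

Lemma kernelP (u : kernel) : f (val u) = 0.
Proof. exact/eqP/(valP u). Qed.

End Kernel.

(** * Idempotents and split maps of indecomposable modules *)

Section Endomorphisms.
Variables (R : pzRingType).
Implicit Types M N : lmodType R.

Lemma bij_linear_inv M N (f : {linear M -> N}) : bijective f ->
  exists2 g : {linear N -> M}, cancel f g & cancel g f.
Proof.
case=> g fK gK.
pose gL := GRing.isLinear.Build _ _ _ _ g (can2_linear fK gK).
pose g' : {linear N -> M} := HB.pack g gL.
by exists g'.
Qed.

(** An idempotent e splits M as ker e + ker (1 - e), so that one of the two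
    kernels vanishes. *)
Lemma idempotent_trivial M (e : {linear M -> M}) :
    indecomposable M -> (forall x, e (e x) = e x) ->
  (forall x, e x = 0) \/ (forall x, e x = x).
Proof.
case=> _ indM ee.
pose e' : {linear M -> M} := idfun \- e.
have ke x : x - e x \in ker_pred e by rewrite inE raddfB /= ee subrr.
have ke' x : e x \in ker_pred e' by rewrite inE /= ee subrr.
pose split x : (kernel e * kernel e')%type := (Kernel (ke x), Kernel (ke' x)).
have split_lin : linear split.
  move=> a x y; congr pair; apply/val_inj; rewrite /= linearP //.
  by rewrite scalerBr opprD addrACA.
pose sL := GRing.isLinear.Build _ _ _ _ split split_lin.
pose split' : {linear M -> (kernel e * kernel e')%type} := HB.pack split sL.
have iso : iso_mod M (kernel e * kernel e')%type.
  exists split'; exists (fun u => val u.1 + val u.2) => [x|[u v]].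
    by rewrite /= subrK.
  have eu := kernelP u; have /eqP := kernelP v; rewrite subr_eq0 => /eqP ev.
  congr pair; apply/val_inj; rewrite /= raddfD /= eu add0r -ev //.
  by rewrite addrK.
case: (indM _ _ iso) => z; [right|left] => x.
  apply/esym/eqP; rewrite -subr_eq0; apply/eqP.
  by have /(congr1 val) := z (Kernel (ke x)); rewrite raddf0.
by have /(congr1 val) := z (Kernel (ke' x)); rewrite raddf0.
Qed.

(** The composite k r is an idempotent of N; it is not 0 because r k = 1 on
    M <> 0. *)
Lemma section_bijective M N (k : {linear M -> N}) (r : {linear N -> M}) :
  ~ zero_mod M -> indecomposable N -> cancel k r -> bijective k.
Proof.
move=> nzM indN kK.
have [x | kr0 | krK] := @idempotent_trivial N (k \o r) indN.
- by rewrite /= kK.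
- case: nzM => x; have := kr0 (k x); rewrite /= kK => kx0.
  by rewrite -[x]kK kx0 linear0.
- by exists r.
Qed.

Lemma retraction_bijective M N (k : {linear M -> N}) (r : {linear N -> M}) :
  ~ zero_mod M -> indecomposable N -> cancel k r -> bijective r.
Proof.
move=> nzM indN kK.
exact: (bij_can_bij (section_bijective nzM indN kK)) kK.
Qed.

End Endomorphisms.

(** * Endomorphism rings of indecomposable modules are local *)

Section Scalars.
Variables (K : fieldType) (A : algType K) (M : rmodType A).

(** The action of the base field on a right A-module; it is A-linear because
    scalars are central in A. *)
Definition scal (c : K) (x : M) : M := (c%:A : A^c) *: x.

Fact scal_linear c : linear (scal c).
Proof.
move=> a x y; rewrite /scal scalerDr !scalerA; congr (_ *: _ + _).
(* Products in A^c are products in A with the factors exchanged. *)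
by change ((a : A) * c%:A = c%:A * (a : A)); rewrite mulr_algl mulr_algr.
Qed.
HB.instance Definition _ c := GRing.isLinear.Build _ _ _ _ (scal c)
  (scal_linear c).

Lemma scalDl c d x : scal (c + d) x = scal c x + scal d x.
Proof. by rewrite /scal -scalerDl -[in RHS]scalerDl. Qed.

Lemma scalA c d x : scal (c * d) x = scal c (scal d x).
Proof.
rewrite /scal scalerA; congr (_ *: _).
by change ((c * d)%:A = d%:A * c%:A :> A); rewrite mulr_algl scalerA mulrC.
Qed.

Definition spans (T : finType) (e : T -> M) :=
  forall x, exists c : T -> K, x = \sum_i scal (c i) (e i).

(** The extra generator 0 makes the number of generators positive for free, as
    required by the ring structure on square matrices. *)
Lemma spans_ord (T : finType) (e : T -> M) :
  spans e -> exists n (e' : 'I_n.+1 -> M), spans e'.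
Proof.
move=> se; exists #|T|, (fun i => oapp (e \o enum_val) 0 (unlift ord0 i)) => x.
have [c ->] := se x.
exists (fun i => oapp (c \o enum_val) 0 (unlift ord0 i)).
rewrite big_ord_recl unlift_none /= linear0 add0r.
rewrite (reindex (@enum_val T T)) /=; last first.
  by apply: onW_bij; apply: enum_val_bij.
by apply: eq_bigr => i _; rewrite liftK.
Qed.

Variables (n : nat) (e : 'I_n.+1 -> M).
Hypothesis se : spans e.

Definition lin_comb (v : 'rV[K]_n.+1) : M := \sum_i scal (v 0 i) (e i).

Lemma lin_combD v w : lin_comb (v + w) = lin_comb v + lin_comb w.
Proof.
by rewrite -big_split; apply: eq_bigr => i _; rewrite mxE scalDl.
Qed.

Lemma lin_combZ c v : lin_comb (c *: v) = scal c (lin_comb v).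
Proof. by rewrite linear_sum; apply: eq_bigr => i _; rewrite mxE scalA. Qed.

Lemma lin_comb0 : lin_comb 0 = 0.
Proof. by rewrite -(scale0r 0) lin_combZ /scal !scale0r. Qed.

Lemma lin_comb_surj x : exists v, lin_comb v = x.
Proof.
have [c ->] := se x; exists (\row_i c i).
by apply: eq_bigr => i _; rewrite mxE.
Qed.

(** The matrix F acts on coordinates as f does on M.  The generators need not
    form a basis, so F is not determined by f, but f is by F. *)
Definition represents (F : 'M[K]_n.+1) (f : M -> M) :=
  forall v, lin_comb (v *m F) = f (lin_comb v).

Lemma representable (f : {linear M -> M}) : exists F, represents F f.
Proof.
have [r rP] := choice lin_comb_surj.
exists (\matrix_i r (f (e i))) => v.
rewrite mulmx_sum_row (big_morph lin_comb lin_combD lin_comb0).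
rewrite linear_sum; apply: eq_bigr => i _.
by rewrite lin_combZ rowK rP /scal linearZ.
Qed.

(** If F represents an A-linear map then so does every polynomial in F: A-linear
    maps contain the scalars and are closed under sums and composites. *)
Lemma represents_horner F (f : {linear M -> M}) (p : {poly K}) :
  represents F f ->
  exists g : {linear M -> M}, represents (horner_mx F p) g.
Proof.
move=> Ff; elim/poly_ind: p => [|p c [g pg]].
  by exists \0 => v; rewrite rmorph0 mulmx0 lin_comb0.
exists (f \o g \+ scal c) => v.
rewrite rmorphD rmorphM /= horner_mx_X horner_mx_C mulmxDr mulmxA.
by rewrite lin_combD Ff pg mul_mx_scalar lin_combZ.
Qed.

(** The evaluation p |-> p(f) from K[X] to A-linear endomorphisms.  Its
    multiplicativity and a nonzero polynomial in its kernel, the characteristic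
    one, are inherited from the evaluation at a matrix that represents f. *)
Lemma polynomial_calculus (f : {linear M -> M}) :
  exists G : {poly K} -> {linear M -> M},
    [/\ forall p q x, G (p + q) x = G p x + G q x,
        forall p q x, G (p * q) x = G p (G q x),
        forall x, G 1 x = x,
        forall x, G 'X x = f x
      & exists2 p, p != 0 & forall x, G p x = 0].
Proof.
have [F Ff] := representable f.
have [G GP] := choice (fun p => represents_horner p Ff).
have Gv p v : G p (lin_comb v) = lin_comb (v *m horner_mx F p) by rewrite GP.
exists G; split=> [p q x|p q x|x|x|]; try have [v <-] := lin_comb_surj x.
- by rewrite !Gv rmorphD mulmxDr lin_combD.
- by rewrite !Gv mulrC rmorphM /= mulmxA.
- by rewrite Gv rmorph1 mulmx1.
- by rewrite Gv horner_mx_X Ff.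
exists (char_poly F); first exact/monic_neq0/char_poly_monic.
move=> x; have [v <-] := lin_comb_surj x.
by rewrite Gv Cayley_Hamilton mulmx0 lin_comb0.
Qed.

(** Fitting's lemma, in the form that makes End M a local ring. *)
Lemma fitting_bijective (f : {linear M -> M}) : indecomposable M ->
  bijective f \/ bijective (idfun \- f : {linear M -> M}).
Proof.
move=> indM; have [nzM _] := indM.
have [G [GD GM G1 GX [p p_nz Gp]]] := polynomial_calculus f.
(* The spare factor 'X ensures that 0 is a root, so that the multiplicity m is
   positive. *)
have [m [q]] := multiplicity_XsubC ('X * p) 0.
rewrite mulf_neq0 ?polyX_eq0 //= polyC0 subr0 => q0 Dp.
have Gqm r x : G (r * (q * 'X^m)) x = 0.
  by rewrite -Dp GM GM Gp !linear0.
case: m => [|m] in Dp Gqm *.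
  by case/negP: q0; rewrite -[q]mulr1 -[1](expr0 'X) -Dp rootM rootX eqxx.
have /Bezout_eq1_coprimepP [[u v] /= uv] : coprimep q 'X^(m.+1).
  by rewrite coprimep_expr // coprimepX.
have GE r s t : r = s + t * (q * 'X^(m.+1)) -> forall x, G r x = G s x.
  by move=> -> x; rewrite GD Gqm addr0.
have [x | V0 | V1] := @idempotent_trivial _ M (G (v * 'X^(m.+1))) indM.
- rewrite -GM; apply: (GE _ _ (- (v * u))).
  have {2}-> : v * 'X^(m.+1) = 1 - u * q by rewrite -uv addrC addKr.
  by ring.
(* The idempotent v(f) f^(m+1) vanishes, hence f^(m+1) = 0 and the geometric sum
   is inverse to 1 - f. *)
- right; apply: (@retraction_bijective _ M M (G (\sum_(i < m.+1) 'X^i))) => //.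
  have GfX x : (idfun \- f : {linear M -> M}) x = G (1 - 'X) x.
    by apply: (addIr (f x)); rewrite /= subrK -GX -GD subrK G1.
  move=> x; rewrite GfX -GM.
  rewrite (GE _ (1 - 'X^(m.+1) * (v * 'X^(m.+1))) (- u)).
    by rewrite -mulNr GD GM V0 linear0 addr0 G1.
  rewrite -(opprB 'X 1) [LHS]mulNr -(subrX1 'X m.+1) opprB.
  by rewrite -{1}['X^(m.+1)]mulr1 -uv; ring.
(* The idempotent v(f) f^(m+1) is the identity, hence v(f) f^m is inverse to f. *)
- left; apply: (@retraction_bijective _ M M (G (v * 'X^m))) => // x.
  by rewrite -GX -GM mulrCA -exprS V1.
Qed.

(** * Nakayama's lemma over the endomorphism ring *)

Section Nakayama.
Hypothesis indM : indecomposable M.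

Lemma not_bij_compl (h j : {linear M -> M}) :
  ~ bijective j -> ~ bijective (h \o j).
Proof.
move=> nj /bij_linear_inv[g hjK _]; apply: nj.
exact: (@section_bijective _ M M j (g \o h) indM.1 indM hjK).
Qed.

Lemma not_bij_compr (j h : {linear M -> M}) :
  ~ bijective j -> ~ bijective (j \o h).
Proof.
move=> nj /bij_linear_inv[g _ jhK]; apply: nj.
exact: (@retraction_bijective _ M M (h \o g) j indM.1 indM jhK).
Qed.

Lemma not_bij0 : ~ bijective (\0 : {linear M -> M}).
Proof. by case=> g gK _; apply: indM.1 => x; rewrite -[x]gK -[RHS]gK. Qed.

(** In a local ring, if j + k is a unit with inverse g then g j or g k = 1 - g j
    is a unit. *)
Lemma not_bijD (j k : {linear M -> M}) :
  ~ bijective j -> ~ bijective k -> ~ bijective (j \+ k).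
Proof.
move=> nj nk /bij_linear_inv[g jkK _].
have [/(not_bij_compl nj) //|] := fitting_bijective (g \o j) indM.
move=> b; apply: (not_bij_compl (h := g) nk); apply: (eq_bij b) => x /=.
by apply: (addrI (g (j x))); rewrite addrC subrK -linearD; apply/esym/jkK.
Qed.

Definition endo_stable (W : M -> Prop) : Prop :=
  [/\ W 0, forall x y, W x -> W y -> W (x + y)
    & forall (h : {linear M -> M}) x, W x -> W (h x)].

(** The subset W + P a of M, with P a set of endomorphisms: it is W + E a when P
    is everything and W + J a when P is the set of nonbijective endomorphisms. *)
Definition adjoin (P : {linear M -> M} -> Prop) (W : M -> Prop) (a x : M) :=
  exists2 h, P h & W (x - h a).

Lemma adjoin_stable (P : {linear M -> M} -> Prop) W a :
    P \0 -> (forall h k, P h -> P k -> P (h \+ k)) ->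
    (forall h k : {linear M -> M}, P k -> P (h \o k)) ->
  endo_stable W -> endo_stable (adjoin P W a).
Proof.
move=> P0 PD PM [W0 WD WM]; split=> [|x y [h Ph Wx] [k Pk Wy]|k x [h Ph Wx]].
- by exists \0; rewrite // subr0.
- exists (h \+ k); first exact: PD.
  by rewrite opprD addrACA; apply: WD.
- by exists (k \o h); [apply: PM | rewrite -linearB; apply: WM].
Qed.

(* M = Z + J M, where J is the set of nonbijective endomorphisms. *)
Variable Z : M -> Prop.
Hypothesis Z_gen : forall W, endo_stable W -> (forall x, Z x -> W x) ->
  (forall j : {linear M -> M}, ~ bijective j -> forall y, W (j y)) ->
  forall x, W x.

(** If M = W + E a then J M is contained in W + J a.  The latter is thus all of M
    and contains a, so a - j a lies in W for some j in J.  As 1 - j is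
    invertible, a lies in W. *)
Lemma nakayama_step W a : endo_stable W -> (forall x, Z x -> W x) ->
  (forall x, adjoin xpredT W a x) -> forall x, W x.
Proof.
move=> sW ZW Wa; have [W0 WD WM] := sW.
have [j nj Waj] : adjoin (fun j => ~ bijective j) W a a.
  apply: (Z_gen (W := adjoin (fun j => ~ bijective j) W a)) => [|x Zx|j nj y].
  - by apply: adjoin_stable; [apply: not_bij0 | apply: not_bijD
      | apply: not_bij_compl |].
  - by exists \0; [apply: not_bij0 | rewrite subr0; apply: ZW].
  - have [h _ Wy] := Wa y.
    by exists (j \o h); [apply: not_bij_compr | rewrite -linearB; apply: WM].
have [//|/bij_linear_inv[g jK _]] := fitting_bijective j indM.
have {Waj} Wa' : W a by rewrite -[a]jK; apply: WM.
move=> x; have [h _ Wx] := Wa x.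
by rewrite -[x](subrK (h a)); apply: WD => //; apply: WM.
Qed.

(** The generators of M over K also generate it over E; they are removed one by
    one from M = Z + E a_1 + ... + E a_n. *)
Lemma nakayama : endo_stable Z -> forall x, Z x.
Proof.
move=> sZ; pose adj := foldr (fun a W => adjoin xpredT W a) Z.
have sadj l : endo_stable (adj l) by elim: l => //= a l; apply: adjoin_stable.
have adjZ l x : Z x -> adj l x.
  elim: l => //= a l IHl Zx; exists \0 => //; rewrite subr0; exact: IHl.
have descend l : (forall x, adj l x) -> forall x, Z x.
  elim: l => //= a l IHl all_l; apply: IHl.
  exact: (nakayama_step (sadj l) (@adjZ l) all_l).
apply: (descend [seq e i | i <- index_enum _]) => x; have [c ->] := se x.
elim: (index_enum _) => [|i l IHl] /=; first by rewrite big_nil; case: sZ.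
by exists (scal (c i)) => //; rewrite big_cons addrAC subrr add0r.
Qed.

End Nakayama.

End Scalars.

(** The products of generators of M with a basis of A span M over K. *)
Lemma fin_gen_spans (K : fieldType) (A : falgType K) (M : rmodType A) :
  fin_gen M -> exists n (e : 'I_n.+1 -> M), spans e.
Proof.
move=> [n [g gP]]; pose b := vbasis {:A}.
apply: (@spans_ord _ _ _ ('I_n * 'I_(\dim {:A}))%type
          (fun ij => (b`_ij.2 : A^c) *: g ij.1)) => x.
have [c ->] := gP x.
exists (fun ij => coord b ij.2 (c ij.1)).
rewrite -(pair_bigA _ (fun i j => scal (coord b j (c i)) ((b`_j : A^c) *: g i))).
apply: eq_bigr => i _ /=.
rewrite [in LHS](coord_vbasis (memvf (c i : A))).
rewrite (@scaler_suml A^c); apply: eq_bigr => j _.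
rewrite /scal scalerA; congr (_ *: _).
change (coord b j (c i) *: b`_j = b`_j * (coord b j (c i))%:A).
by rewrite mulr_algr.
Qed.

(** * Traces and generation *)

Section Injections.
Variables (R : pzRingType) (M N : lmodType R).

Definition inL (x : M) : (M * N)%type := (x, 0).
Definition inR (y : N) : (M * N)%type := (0, y).

Fact inL_linear : linear inL.
Proof. by move=> a x y; congr pair; rewrite /= scaler0 addr0. Qed.
HB.instance Definition _ := GRing.isLinear.Build _ _ _ _ inL inL_linear.

Fact inR_linear : linear inR.
Proof. by move=> a x y; congr pair; rewrite /= scaler0 addr0. Qed.
HB.instance Definition _ := GRing.isLinear.Build _ _ _ _ inR inR_linear.

Lemma pair_inLR x y : (x, y) = inL x + inR y.
Proof. by congr pair; rewrite ?addr0 ?add0r. Qed.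

End Injections.

Section Trace.
Variables (R : pzRingType) (I : Type) (S : I -> lmodType R).
Implicit Types (M N : lmodType R) (Q : set I).

(** An element of a direct sum is the sum of its components, so a property that
    is stable under sums only has to be checked on images of single members. *)
Lemma Gen_add_ind Q M (W : M -> Prop) : Gen_add S Q M ->
    W 0 -> (forall x y, W x -> W y -> W (x + y)) ->
    (forall i (h : {linear S i -> M}) u, Q i -> W (h u)) ->
  forall x, W x.
Proof.
move=> [s [Qs [f fP]]] W0 WD WQ x; have [u <-] := fP x.
elim: Qs f u {fP} => [|i {}s Qi _ IHs] f u.
  by rewrite [u]thinmx0 linear0.
case: u => a u; rewrite pair_inLR linearD; apply: WD.
  exact: (WQ i (f \o @inL _ (S i) (dsum S s))).
exact: (IHs (f \o @inR _ (S i) (dsum S s))).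
Qed.

(** The trace of Q in M, i.e. the sum of the images of all maps from members of Q
    to M; each element of this sum lies in the image of one map from a direct
    sum. *)
Definition trace Q M (x : M) : Prop :=
  exists s, List.Forall Q s /\
    exists (f : {linear dsum S s -> M}) u, f u = x.

(** Directedness of the family of images: the components of f1 are added to f2
    one by one. *)
Lemma trace_join Q M s1 s2 (f1 : {linear dsum S s1 -> M})
    (f2 : {linear dsum S s2 -> M}) :
    List.Forall Q s1 -> List.Forall Q s2 ->
  exists s, List.Forall Q s /\ exists f : {linear dsum S s -> M},
    (forall u, exists w, f w = f1 u) /\ (forall u, exists w, f w = f2 u).
Proof.
move=> Qs1 Qs2; elim: Qs1 f1 => [|i {}s1 Qi _ IHs] f1.
  exists s2; split=> //; exists f2; split=> u; last by exists u.
  by exists 0; rewrite [u]thinmx0 !linear0.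
have [s [Qs [f [ff1 ff2]]]] := IHs (f1 \o @inR _ (S i) (dsum S s1)).
exists (i :: s); split; first exact: List.Forall_cons.
pose h : {linear (S i * dsum S s)%type -> M} :=
  (f1 \o @inL _ (S i) (dsum S s1) \o @fst (S i) (dsum S s)) \+
    (f \o @snd (S i) (dsum S s)).
exists h; split=> [[a u]|u].
  have [w fw] := ff1 u; exists (a, w).
  by rewrite /= fw -linearD -pair_inLR.
by have [w fw] := ff2 u; exists (0, w); rewrite /= fw !linear0 add0r.
Qed.

Lemma traceD Q M (x y : M) : trace Q x -> trace Q y -> trace Q (x + y).
Proof.
move=> [s1 [Qs1 [f1 [u1 <-]]]] [s2 [Qs2 [f2 [u2 <-]]]].
have [s [Qs [f [ff1 ff2]]]] := trace_join f1 f2 Qs1 Qs2.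
exists s; split=> //; have [[w1 <-] [w2 <-]] := (ff1 u1, ff2 u2).
by exists f, (w1 + w2); rewrite linearD.
Qed.

Lemma trace_linear Q M N (h : {linear M -> N}) x : trace Q x -> trace Q (h x).
Proof. by move=> [s [Qs [f [u <-]]]]; exists s; split=> //; exists (h \o f), u. Qed.

Lemma trace0 Q M : trace Q (0 : M).
Proof. by exists [::]; split; [constructor | exists \0, 0]. Qed.

Lemma trace_member Q M i (h : {linear S i -> M}) u : Q i -> trace Q (h u).
Proof.
move=> Qi; exists [:: i]; split; first by repeat constructor.
pose f : {linear (S i * dsum S [::])%type -> M} := h \o fst.
by exists f, (u, 0).
Qed.

(** A single map from a direct sum, by directedness, already reaches the finitely
    many generators of M. *)
Lemma Gen_add_trace Q M : fin_gen M -> (forall x : M, trace Q x) -> Gen_add S Q M.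
Proof.
move=> [n [g gP]] trM.
have fin (l : seq 'I_n) : exists s, List.Forall Q s /\
    exists f : {linear dsum S s -> M},
    forall i, i \in l -> exists u, f u = g i.
  elim: l => [|i l [s2 [Qs2 [f2 f2P]]]].
    by exists [::]; split; [constructor | exists \0].
  have [s1 [Qs1 [f1 [u1 f1u]]]] := trM (g i).
  have [s [Qs [f [ff1 ff2]]]] := trace_join f1 f2 Qs1 Qs2.
  exists s; split=> //; exists f => j; rewrite inE => /predU1P[->|/f2P[u2 <-]].
    by rewrite -f1u.
  exact: ff2.
have [s [Qs [f fP]]] := fin (enum 'I_n).
exists s; split=> //; exists f => x; have [c ->] := gP x.
have [u uP] := choice (fun i => fP i (mem_enum _ i)).
exists (\sum_i c i *: u i); rewrite linear_sum; apply: eq_bigr => i _.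
by rewrite linearZ uP.
Qed.

End Trace.

Theorem proposition2p13 (K : fieldType) (A : falgType K)
    (ind : Type) (S : ind -> rmodType A) (S_rep : ind_representatives S)
    (Q : set ind) (Q_closed : qcl S Q = Q)
    (X Y : ind) (XnQ : (~` Q) X) (YnQ : (~` Q) Y) (neqXY : X <> Y) :
  qcl S (Q `|` [set Y]) X -> ~ qcl S (Q `|` [set X]) Y.
Proof.
move=> genX genY; have [S_ind _ S_inj] := S_rep.
have [[fgX indX] [_ indY]] := (S_ind X, S_ind Y).
case: XnQ; rewrite -Q_closed; apply: (Gen_add_trace fgX).
have [n [e se]] := fin_gen_spans fgX.
apply: (nakayama se indX) => [W [W0 WD WM] trW nbW|]; last first.
  by split; [apply: trace0 | apply: traceD | apply: trace_linear].
apply: (Gen_add_ind genX) => // i h u [Qi|Yi].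
  exact/trW/trace_member.
move: h u; rewrite (Yi : i = Y) => {i Yi} h.
apply: (Gen_add_ind (W := fun y => W (h y)) genY) => [|x y Wx Wy|j k u [Qj|Xj]].
- by rewrite linear0.
- by rewrite linearD; apply: WD.
- exact/trW/(@trace_member _ _ _ _ _ _ (h \o k)).
move: k u; rewrite (Xj : j = X) => {j Xj} k u.
have [/bij_linear_inv[g hkK _]|nhk] := pselect (bijective (h \o k)); last first.
  exact: (nbW (h \o k)).
case: neqXY; apply: S_inj; exists k.
exact: (@section_bijective _ _ _ k (g \o h) indX.1 indY hkK).
Qed.
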